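(* Let $\mathcal{E}=(L|K,v)$ be a Galois defect extension of prime degree with Galois group $G$. Then the set $\Sigma_\sigma$ does not depend on the choice of the generator $\sigma$ of $G$; writing $\Sigma_\mathcal{E}$ for it, $\Sigma_\mathcal{E}$ is a final segment of $vK^{>0}$ and $$\Sigma_\mathcal{E}=\Sigma_+(1)=\Sigma_-(G).$$ Hence the ramification ideal $I_-(G)=I_+(1)$ equals the ideal of $\mathcal{O}_L$ generated by $\{(\sigma f-f)/f\mid f\in L^\times\}$, for any generator $\sigma$ of $G$. If $\operatorname{char}K=p$ and $a$ is any Artin–Schreier generator of $L|K$ (i.e. $L=K(a)$ and $a^p-a\in K$), then $\Sigma_\mathcal{E}=-v(a-K)$. If $K$ contains a primitive $p$-th root of unity and $a$ is a Kummer generator of $L|K$ (i.e. $L=K(a)$, $a^p\in K$) which is a 1-unit, then $\Sigma_\mathcal{E}=\frac{vp}{p-1}-v(a-K)$.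
   Context: A Galois defect extension of prime degree is a Galois extension $(L|K,v)$ of prime degree such that $v$ extends uniquely from $K$ to $L$ and the extension has nontrivial defect; then $[L:K]=p=\operatorname{char}Kv$ and $vL=vK$, $Lv=Kv$. For $\sigma\in G$, $\Sigma_\sigma=\{v((\sigma f-f)/f)\mid f\in L^\times,\ \sigma f\ne f\}$. $v(a-K)=\{v(a-c)\mid c\in K\}$; $-v(a-K)=\{-\gamma\mid\gamma\in v(a-K)\}$ and $\frac{vp}{p-1}-v(a-K)=\{\frac{vp}{p-1}-\gamma\mid\gamma\in v(a-K)\}$. A 1-unit is an element $u$ with $v(u-1)>0$. Higher ramification groups: for an ideal $I$ of $\mathcal{O}_L$, $G_I=\{\sigma\in G\mid(\sigma f-f)/f\in I\ \forall f\in L^\times\}$; for a final segment $\Sigma$ of $(vL)^{\ge0}$, $I_\Sigma=\{b\in L\mid vb\in\Sigma\}\cup\{0\}$, $G_\Sigma=G_{I_\Sigma}$; for a subgroup $H$ of $G$, $\Sigma_-(H)=\bigcap\{\Sigma\mid H\subseteq G_\Sigma\}$, $\Sigma_+(H)=\bigcup\{\Sigma\mid G_\Sigma\subseteq H\}$, $I_-(H)=\bigcap\{I\mid H\subseteq G_I\}$, $I_+(H)=\bigcup\{I\mid G_I\subseteq H\}$. Here $1$ denotes the trivial subgroup. *)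

(* Defs.v *)
From HB Require Import structures.
From mathcomp Require Import all_boot all_order all_algebra all_fingroup all_solvable all_field.
Set Implicit Arguments. Unset Strict Implicit. Unset Printing Implicit Defensive.
Import GRing.Theory.
Local Open Scope ring_scope.

Section OrderedGroup.
Variables (Γ : zmodType) (le : rel Γ).

Definition ordered_abelian_group : Prop :=
  [/\ reflexive le, transitive le, antisymmetric le, total le &
      forall x y z, le x y -> le (x + z) (y + z)].

Definition glt (x y : Γ) : bool := le x y && (x != y).

(* Γ ∪ {∞}, with None = ∞ *)
Definition oleq (a b : option Γ) : bool :=
  match a, b with
  | _, None => true
  | None, Some _ => false
  | Some x, Some y => le x y
  end.

Definition oadd (a b : option Γ) : option Γ :=
  match a, b with Some x, Some y => Some (x + y) | _, _ => None end.

Definition opos (a : option Γ) : bool :=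
  match a with None => true | Some x => glt 0 x end.
End OrderedGroup.

Section Valuation.
Variables (Γ : zmodType) (le : rel Γ).

Definition is_valuation (F : fieldType) (v : F -> option Γ) : Prop :=
  [/\ forall x, v x = None <-> x = 0,
      forall x y, v (x * y) = oadd (v x) (v y) &
      forall x y g, oleq le g (v x) -> oleq le g (v y) -> oleq le g (v (x + y))].

Variables (K : fieldType) (L : fieldExtType K) (v : L -> option Γ).

Definition vring (x : L) : Prop := oleq le (Some 0) (v x).

Definition valgroupL (g : Γ) : Prop := exists x : L, x != 0 /\ v x = Some g.
Definition valgroupK (g : Γ) : Prop := exists c : K, c != 0 /\ v c%:A = Some g.

Definition is_valuation_ring (O : L -> Prop) : Prop :=
  [/\ O 1, forall x y, O x -> O y -> O (x - y),
      forall x y, O x -> O y -> O (x * y) &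
      forall x, x != 0 -> O x \/ O x^-1].

(* v|K extends uniquely to L: every valuation ring of L lying over O_K is O_L *)
Definition unique_extension : Prop :=
  forall O : L -> Prop, is_valuation_ring O ->
    (forall c : K, O c%:A <-> vring c%:A) -> forall x, O x <-> vring x.

(* vL contains at least k classes modulo vK *)
Definition ram_at_least (k : nat) : Prop :=
  exists x : 'I_k -> L, (forall i, x i != 0) /\
    forall i j g h, i != j -> v (x i) = Some g -> v (x j) = Some h -> ~ valgroupK (g - h).

(* [Lv : Kv] >= k : k elements of O_L with Kv-linearly independent residues *)
Definition res_at_least (k : nat) : Prop :=
  exists y : 'I_k -> L, (forall i, vring (y i)) /\
    forall c : 'I_k -> K, (forall i, vring (c i)%:A) ->
      opos le (v (\sum_i (c i)%:A * y i)) -> forall i, opos le (v (c i)%:A).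

(* nontrivial defect: e * f < [L:K], where e = (vL : vK), f = [Lv : Kv] *)
Definition nontrivial_defect : Prop :=
  ~ exists e f : nat, (\dim {:L} <= e * f)%N /\ ram_at_least e /\ res_at_least f.
End Valuation.

Section Ramification.
Variables (Γ : zmodType) (le : rel Γ).
Variables (K : fieldType) (L : splittingFieldType K) (v : L -> option Γ).

Notation G := ('Gal({:L} / 1%VS))%G.

Definition Sigma (s : gal_of {:L}) (g : Γ) : Prop :=
  exists f : L, [/\ f != 0, s f != f & v ((s f - f) / f) = Some g].

Definition final_segment_vL_ge0 (S : Γ -> Prop) : Prop :=
  (forall g, S g -> valgroupL v g /\ le 0 g) /\
  (forall g h, S g -> valgroupL v h -> le g h -> S h).

Definition final_segment_vK_gt0 (S : Γ -> Prop) : Prop :=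
  (forall g, S g -> valgroupK v g /\ glt le 0 g) /\
  (forall g h, S g -> valgroupK v h -> glt le 0 h -> le g h -> S h).

Definition is_ideal (I : L -> Prop) : Prop :=
  [/\ forall x, I x -> vring le v x, I 0,
      forall x y, I x -> I y -> I (x + y) &
      forall r x, vring le v r -> I x -> I (r * x)].

Definition ideal_of (S : Γ -> Prop) (b : L) : Prop :=
  b = 0 \/ exists g, v b = Some g /\ S g.

Definition GI (I : L -> Prop) (s : gal_of {:L}) : Prop :=
  s \in G /\ forall f : L, f != 0 -> I ((s f - f) / f).

Definition GSigma (S : Γ -> Prop) := GI (ideal_of S).

Definition subgroup_in (H : {group gal_of {:L}}) (P : gal_of {:L} -> Prop) :=
  forall s, s \in H -> P s.
Definition in_subgroup (P : gal_of {:L} -> Prop) (H : {group gal_of {:L}}) :=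
  forall s, P s -> s \in H.

Definition Sigma_minus (H : {group gal_of {:L}}) (g : Γ) : Prop :=
  forall S, final_segment_vL_ge0 S -> subgroup_in H (GSigma S) -> S g.
Definition Sigma_plus (H : {group gal_of {:L}}) (g : Γ) : Prop :=
  exists S, [/\ final_segment_vL_ge0 S, in_subgroup (GSigma S) H & S g].

Definition I_minus (H : {group gal_of {:L}}) (x : L) : Prop :=
  forall I, is_ideal I -> subgroup_in H (GI I) -> I x.
Definition I_plus (H : {group gal_of {:L}}) (x : L) : Prop :=
  exists I, [/\ is_ideal I, in_subgroup (GI I) H & I x].

Definition ideal_gen (A : L -> Prop) (x : L) : Prop :=
  forall I, is_ideal I -> (forall y, A y -> I y) -> I x.

Definition ramif_elems (s : gal_of {:L}) (x : L) : Prop :=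
  exists f : L, f != 0 /\ x = (s f - f) / f.
End Ramification.

(* Main.v *)
Require Import Defs.
From HB Require Import structures.
From mathcomp Require Import all_boot all_order all_algebra all_fingroup all_solvable all_field.
From mathcomp Require Import ring.
From Stdlib Require Import Classical_Prop.
Import GRing.Theory.
Local Open Scope ring_scope.
Set Implicit Arguments. Unset Strict Implicit. Unset Printing Implicit Defensive.

(** Write [O] for the valuation ring of [L], [M] for its maximal ideal, and
    [D = s - 1] for a generator [s] of [G]. Uniqueness of the extension makes
    [v] invariant under [G], so [v N(x) = p v(x)] and nontrivial defect forces
    [vL = vK]. If some [D x / x] were not in [M], the conjugates of a unit
    would be pairwise distinct modulo [M] and its powers would give
    [[Lv : Kv] >= p]; so [D x / x] is always in [M], and then comparing [Tr x]
    with [p x] gives [v p > 0].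

    The key step is that, for [a] outside [K], every polynomial [r] over [K] of
    degree less than [p] is resolved: there are [c], [d] in [K] with
    [(a - c) / d] in [O] and [r(c + dX)] in [r(a) O[X]]. Take an unresolved
    monic [h] of minimal degree [m] and divide [P = prod_s (X - s a)] by it,
    [P = q h + r]. Since [r] is resolved and [h] is not, at a suitable scale [d]
    the polynomial [q(a + dX) h(a + dX)] is congruent modulo [M] to a multiple
    of [P(a + dX)], that is, of [X^p]. Hence [h(a + dX)] is a multiple of [X^m]
    modulo [M], and its coefficient of degree [m - 1] shows that the element
    [c = - h_(m-1) / m] of [K] satisfies [v (a - c) > v d]. This applies again
    with a [d] such that [v d = v (a - c)]: a contradiction.

    Resolving polynomials yields [Lv = Kv], hence [Sigma_s] has no least
    element, and it also yields [Sigma_s = v (D a) - v (a - K)] for every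
    generator [a] of [L], because [f = r(a)] gives [D f / f] in [(D a / d) O]. *)

(** * Valuation rings of a field and polynomials over them *)

Record valring (F : fieldType) := ValRing {
  vr_pred :> {pred F};
  vr_ring : subring_closed vr_pred;
  vr_val : forall x, x != 0 -> (x \in vr_pred) || (x^-1 \in vr_pred) }.

HB.instance Definition _ (F : fieldType) (O : valring F) :=
  GRing.isSubringClosed.Build F (vr_pred O) (vr_ring O).

Section ValuationRing.
Variables (F : fieldType) (O : valring F).
Implicit Types (x y z : F) (A B : {poly F}).

(** The nonunits of [O]. Zero is listed apart because [0^-1 = 0] lies in [O]. *)
Definition maxid : {pred F} := [pred x | (x \in O) && ((x == 0) || (x^-1 \notin O))].
Local Notation M := maxid.

Lemma maxidE x : (x \in M) = (x \in O) && ((x == 0) || (x^-1 \notin O)).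
Proof. by []. Qed.

Lemma maxidO x : x \in M -> x \in O.
Proof. by case/andP. Qed.

Lemma maxid0 : 0 \in M.
Proof. by rewrite inE rpred0 eqxx. Qed.

Lemma maxid1 : 1 \notin M.
Proof. by rewrite inE invr1 rpred1 oner_eq0. Qed.

Lemma notin_valring x : x \notin O -> x^-1 \in M.
Proof.
move=> Ox; have x0 : x != 0 by apply: contraNneq Ox => ->; apply: rpred0.
by rewrite inE invrK Ox orbT andbT; have := vr_val O x0; rewrite (negPf Ox).
Qed.

Lemma valring_unit x : x \in O -> x \notin M -> x^-1 \in O.
Proof. by rewrite inE => -> /=; rewrite negb_or negbK => /andP[]. Qed.

Lemma maxidV x : x != 0 -> (x \in M) = (x^-1 \notin O).
Proof.
move=> x0; rewrite inE (negPf x0) /=; case: (boolP (x^-1 \in O)); rewrite ?andbF //.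
by move=> /notin_valring/maxidO; rewrite invrK => ->.
Qed.

Lemma maxidMl x y : x \in O -> y \in M -> x * y \in M.
Proof.
move=> Ox My; have [->|x0] := eqVneq x 0; first by rewrite mul0r maxid0.
have [->|y0] := eqVneq y 0; first by rewrite mulr0 maxid0.
rewrite maxidV ?mulf_neq0 //; apply: contraL My => Oxy.
by rewrite maxidV // negbK -[y^-1](mulVKf x0) -invfM rpredM.
Qed.

Lemma maxidMr x y : x \in M -> y \in O -> x * y \in M.
Proof. by rewrite mulrC => *; apply: maxidMl. Qed.

Lemma valring_div x y : x != 0 -> y != 0 -> (x / y \in O) || (y / x \in O).
Proof.
move=> x0 y0; have := vr_val O (mulf_neq0 x0 (invr_neq0 y0)).
by rewrite invfM invrK [x^-1 * y]mulrC.
Qed.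

(** Of two nonzero elements one divides the other in [O], so the sum is an [O]-multiple of one of
    them. *)
Lemma maxidD x y : x \in M -> y \in M -> x + y \in M.
Proof.
have [->|x0] := eqVneq x 0; first by rewrite add0r.
have [->|y0] := eqVneq y 0; first by rewrite addr0.
move=> Mx My; have /orP[xy|yx] := valring_div x0 y0.
  have -> : x + y = (x / y + 1) * y by field.
  by rewrite maxidMl // rpredD // rpred1.
have -> : x + y = (y / x + 1) * x by field.
by rewrite maxidMl // rpredD // rpred1.
Qed.

Lemma maxidN x : x \in M -> - x \in M.
Proof. by move=> Mx; rewrite -mulN1r maxidMl // rpredN rpred1. Qed.

Fact maxid_addr_closed : addr_closed M.
Proof. by split; [exact: maxid0 | exact: maxidD]. Qed.

Fact maxid_oppr_closed : oppr_closed M.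
Proof. exact: maxidN. Qed.

HB.instance Definition _ := GRing.isAddClosed.Build F M maxid_addr_closed.
HB.instance Definition _ := GRing.isOppClosed.Build F M maxid_oppr_closed.

Lemma maxidM x y : x \in O -> y \in O -> (x * y \in M) = (x \in M) || (y \in M).
Proof.
move=> Ox Oy; apply/idP/orP; last first.
  by case=> ?; [apply: maxidMr | apply: maxidMl].
move=> Mxy; have [|Mx] := boolP (x \in M); first by left.
have x0 : x != 0 by apply: contraNneq Mx => ->; apply: maxid0.
by right; rewrite -[y](mulKf x0) maxidMl // valring_unit.
Qed.

Lemma maxidX x n : x \in O -> (x ^+ n.+1 \in M) = (x \in M).
Proof.
by move=> Ox; elim: n => // n IHn; rewrite exprS maxidM ?rpredX // IHn orbb.
Qed.

Lemma unitDmaxid x y : x \notin M -> y \in M -> x + y \notin M.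
Proof. by move=> Mx My; rewrite rpredDr. Qed.

Lemma polyOver_maxidO A : A \in polyOver M -> A \in polyOver O.
Proof. by move/polyOverP=> MA; apply/polyOverP => i; apply: maxidO. Qed.

Lemma polyOver_maxidMl A B :
  A \in polyOver O -> B \in polyOver M -> A * B \in polyOver M.
Proof.
move=> /polyOverP OA /polyOverP MB; apply/polyOverP => i.
by rewrite coefM rpred_sum // => j _; apply: maxidMl.
Qed.

Lemma polyOver_maxidZ x A : x \in M -> A \in polyOver O -> x *: A \in polyOver M.
Proof.
by move=> Mx /polyOverP OA; apply/polyOverP => i; rewrite coefZ maxidMr.
Qed.

Lemma lowest_unit_coef A :
    A \in polyOver O -> A \notin polyOver M ->
  exists2 i, A`_i \notin M & forall k, (k < i)%N -> A`_k \in M.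
Proof.
move=> OA MA; have exi : exists i, A`_i \notin M.
  have /allPn[x /(nthP 0)[i _ <-] Mx] : ~~ all (mem M) A by [].
  by exists i.
exists (ex_minn exi); first by case: ex_minnP.
by case: ex_minnP => i _ imin k ki; apply: contraLR ki; rewrite -leqNgt => /imin.
Qed.

(** The mechanism of Gauss's lemma: in the convolution sum every term other than [A]_i * B[_j] has a
    factor in [M]. *)
Lemma lowest_unit_coefM A B i j :
    A \in polyOver O -> B \in polyOver O ->
    A`_i \notin M -> (forall k, (k < i)%N -> A`_k \in M) ->
    B`_j \notin M -> (forall k, (k < j)%N -> B`_k \in M) ->
  (A * B)`_(i + j) \notin M.
Proof.
move=> /polyOverP OA /polyOverP OB Ai Ali Bj Blj.
have lt_i : (i < (i + j).+1)%N by rewrite ltnS leq_addr.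
rewrite coefM (bigD1 (Ordinal lt_i)) //= addKn; apply: unitDmaxid.
  by rewrite maxidM // negb_or Ai.
apply: rpred_sum => k; rewrite -val_eqE /= neq_ltn => /orP[ki | ik].
  by rewrite maxidMr ?Ali.
have := ltn_ord k; rewrite ltnS => kij.
by rewrite maxidMl // Blj // ltn_subLR // ltn_add2r.
Qed.

(** Divisibility in [O] is a total preorder, so a finite family has a member [k] of least value. *)
Lemma seq_max_div (s : seq F) :
  has (predC1 0) s -> exists k, [/\ k \in s, k != 0 & {in s, forall x, x / k \in O}].
Proof.
elim: s => //= x s IHs; have [s0|] := boolP (has (predC1 0) s).
  move=> _; have [k [ks k0 kmax]] := IHs s0.
  have [->|x0] := eqVneq x 0.
    exists k; split=> //; rewrite ?inE ?ks ?orbT // => y.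
    by rewrite inE => /predU1P[->|/kmax//]; rewrite mul0r rpred0.
  have /orP[xk|kx] := valring_div x0 k0.
    exists k; split; rewrite ?inE ?ks ?orbT // => y.
    by rewrite inE => /predU1P[->|/kmax//].
  exists x; split; rewrite ?inE ?eqxx // => y.
  rewrite inE => /predU1P[->|/kmax yk]; first by rewrite divff ?rpred1.
  by have -> : y / x = y / k * (k / x) by [field; rewrite x0 k0]; rewrite rpredM.
move=> s0; rewrite orbF => x0; exists x; split; rewrite ?inE ?eqxx // => y.
rewrite inE => /predU1P[->|ys]; first by rewrite divff ?rpred1.
have /eqP-> : y == 0 by move/hasPn: s0 => /(_ y ys) /=; rewrite negbK.
by rewrite mul0r rpred0.
Qed.

(** Take for [k] a coefficient of least value: scaling by [k^-1] turns that coefficient into 1. *)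
Lemma poly_content A : A != 0 ->
  exists2 k, k != 0 & (k^-1 *: A \in polyOver O) && (k^-1 *: A \notin polyOver M).
Proof.
move=> A0; have /seq_max_div[k [kA k0 kmax]] : has (predC1 0) A.
  apply/hasP; exists (lead_coef A); rewrite /= ?lead_coef_eq0 //.
  by rewrite /lead_coef mem_nth // -subn1 ltn_subrL /= lt0n size_poly_eq0.
exists k => //; apply/andP; split.
  apply/polyOverP => i; rewrite coefZ mulrC.
  have [iA|iA] := ltnP i (size A); first by rewrite kmax ?mem_nth.
  by rewrite nth_default // mul0r rpred0.
apply/polyOverP => Mk; case/(nthP 0): kA => i _ Ai; have := Mk i.
by rewrite coefZ Ai mulVf // (negPf maxid1).
Qed.

Lemma polyOver_XsubC x : x \in O -> 'X - x%:P \in polyOver O.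
Proof. by move=> Ox; rewrite rpredB ?polyOverX ?polyOverC. Qed.

(** Translating by [x], splitting off the constant coefficient and translating back shows that the
    quotient keeps its coefficients in [O]. *)
Lemma polyOver_factor A x : A \in polyOver O -> x \in O ->
  exists B, [/\ B \in polyOver O, (size B <= (size A).-1)%N &
                A = A.[x]%:P + B * ('X - x%:P)].
Proof.
move=> OA Ox; set C := A \Po ('X + x%:P).
have OC : C \in polyOver O by rewrite polyOver_comp // rpredD ?polyOverX ?polyOverC.
have szX : size ('X + x%:P) = 2 by rewrite size_XaddC.
exists (drop_poly 1 C \Po ('X - x%:P)); split.
- apply: polyOver_comp; last exact: polyOver_XsubC.
  by apply/polyOverP => i; rewrite coef_drop_poly; apply/polyOverP.
- by rewrite size_comp_poly2 ?size_XsubC // size_drop_poly size_comp_poly2 // subn1.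
have C0 : take_poly 1 C = (A.[x])%:P.
  apply/polyP => i; rewrite coef_take_poly coefC; case: i => //=.
  by rewrite -horner_coef0 horner_comp !hornerE.
have := poly_take_drop 1 C; rewrite C0 expr1 => /(congr1 (fun D => D \Po ('X - x%:P))).
rewrite comp_polyD comp_polyM comp_polyX comp_polyC => ->.
by rewrite /C -comp_polyA comp_polyD comp_polyX comp_polyC addrNK comp_polyXr.
Qed.

(** Over the residue field this is the bound on the number of roots; the induction splits off one
    linear factor at a time. *)
Lemma polyOver_maxid_roots (s : seq F) A :
    A \in polyOver O -> (size A <= size s)%N -> {subset s <= O} ->
    pairwise (fun x y => x - y \notin M) s ->
    {in s, forall x, A.[x] \in M} -> A \in polyOver M.
Proof.
elim: s A => [|x s IHs] A OA.
  by rewrite leqn0 size_poly_eq0 => /eqP-> *; rewrite rpred0.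
move=> /= szA sO /andP[/allP xs ps] rA.
have Ox : x \in O by rewrite sO ?mem_head.
have [B [OB szB AB]] := polyOver_factor OA Ox.
have MAx : A.[x] \in M by rewrite rA ?mem_head.
suff MB : B \in polyOver M.
  by rewrite AB rpredD ?polyOverC // mulrC polyOver_maxidMl // polyOver_XsubC.
have sO' : {subset s <= O} by move=> y ys; rewrite sO // inE ys orbT.
apply: IHs => //; first by rewrite (leq_trans szB) // -subn1 leq_subLR.
move=> y ys; have Oy := sO' y ys.
have : A.[y] \in M by rewrite rA // inE ys orbT.
rewrite AB !hornerE rpredDl // maxidM; [|exact: rpred_horner|exact: rpredB].
by case/orP=> // Myx; have := xs y ys; rewrite -opprB rpredN Myx.
Qed.
End ValuationRing.

(** * Substitution of [dX + a] into polynomials *)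

Section AffineSubstitution.
Variable F : fieldType.
Implicit Types (a d : F) (h : {poly F}).

Lemma size_affine d a : d != 0 -> size (d *: 'X + a%:P) = 2.
Proof.
move=> d0; rewrite size_polyDl ?size_scale ?size_polyX //.
exact: leq_ltn_trans (size_polyC_leq1 a) _.
Qed.

Lemma comp_affine_affine h d a u w :
  (h \Po (d *: 'X + a%:P)) \Po (u *: 'X + w%:P)
    = h \Po ((d * u) *: 'X + (d * w + a)%:P).
Proof.
rewrite -comp_polyA; congr (_ \Po _).
rewrite comp_polyD comp_polyZ comp_polyX comp_polyC scalerDr scalerA.
by rewrite polyCD polyCM mul_polyC addrA.
Qed.

Lemma size_affine_leq d a : (size (d *: 'X + a%:P)%R <= 2)%N.
Proof.
rewrite (leq_trans (size_polyD _ _)) // geq_max (leq_trans (size_scale_leq _ _)).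
  by rewrite (leq_trans (size_polyC_leq1 _)).
by rewrite size_polyX.
Qed.

Lemma size_affineX d a n : (size ((d *: 'X + a%:P) ^+ n)%R <= n.+1)%N.
Proof.
rewrite (leq_trans (size_poly_exp_leq _ _)) // ltnS -[leqRHS]mul1n leq_mul2r.
by rewrite -subn1 leq_subLR size_affine_leq orbT.
Qed.

Lemma coef_affineXn d a n : ((d *: 'X + a%:P) ^+ n)`_n = d ^+ n.
Proof.
elim: n => [|n IHn]; first by rewrite !expr0 coef1.
rewrite exprS mulrDl -scalerAl coefD coefZ coefXM coefCM IHn exprS.
rewrite [X in a * X]nth_default ?mulr0 ?addr0 //.
exact: size_affineX.
Qed.

Lemma coef_affineXn_pred d a n :
  ((d *: 'X + a%:P) ^+ n.+1)`_n = n.+1%:R * a * d ^+ n.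
Proof.
elim: n => [|n IHn]; first by rewrite expr1 !coefE mulr0 add0r mul1r expr0 mulr1.
rewrite exprS mulrDl -scalerAl coefD coefZ coefXM coefCM IHn coef_affineXn.
by rewrite /= exprS -[n.+2]addn1 natrD; ring.
Qed.

Lemma size_comp_affine h d a : d != 0 -> size (h \Po (d *: 'X + a%:P)) = size h.
Proof. by move=> d0; rewrite size_comp_poly2 // size_affine. Qed.

Lemma coef_comp_affine h d a n : d != 0 -> h \is monic -> size h = n.+2 ->
  (h \Po (d *: 'X + a%:P))`_n.+1 = d ^+ n.+1 /\
  (h \Po (d *: 'X + a%:P))`_n = (h`_n + n.+1%:R * a) * d ^+ n.
Proof.
move=> d0 /monicP hm sh; have hn : h`_n.+1 = 1 by rewrite -hm lead_coefE sh.
set g := take_poly n h; have hE : h = g + (h`_n *: 'X^n + 'X^(n.+1)).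
  apply/polyP => i; rewrite !coefD coefZ !coefXn coef_take_poly.
  have [lin|] := ltnP i n; first by rewrite ltn_eqF // ltn_eqF ?leqW // mulr0 !addr0.
  rewrite leq_eqVlt => /predU1P[<-|]; first by rewrite eqxx ltn_eqF // mulr1 addr0 add0r.
  rewrite leq_eqVlt => /predU1P[<-|ni].
    by rewrite eqxx gtn_eqF // mulr0 !add0r hn.
  by rewrite nth_default ?sh // (gtn_eqF ni) (gtn_eqF (ltnW ni)) mulr0 !addr0.
have sg : (size (g \Po (d *: 'X + a%:P))%R <= n)%N.
  by rewrite size_comp_affine // size_take_poly.
have compXn k : 'X^k \Po (d *: 'X + a%:P) = (d *: 'X + a%:P) ^+ k.
  by rewrite rmorphXn /= comp_polyX.
have hcomp : h \Po (d *: 'X + a%:P) = g \Po (d *: 'X + a%:P)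
    + (h`_n *: (d *: 'X + a%:P) ^+ n + (d *: 'X + a%:P) ^+ n.+1).
  by rewrite {1}hE !comp_polyD comp_polyZ !compXn.
rewrite hcomp !coefD !coefZ !coef_affineXn coef_affineXn_pred.
rewrite (nth_default 0 sg) (nth_default 0 (leqW sg)).
rewrite (nth_default 0 (size_affineX d a n)) mulr0 !add0r; split=> //; ring.
Qed.
End AffineSubstitution.

(** * Resolving polynomials by centers and radii in the base field *)

Section Approximation.
Variables (K : fieldType) (L : fieldExtType K) (O : valring L).
Variables (a : L) (s : seq L).
Local Notation M := (maxid O).
Local Notation P := (\prod_(b <- s) ('X - b%:P)).

(* The value of [r] at [a] is at most its Gauss value with respect to the center [c]
   and the radius [d]; when [(a - c) / d] is in [O] the two are therefore equal. *)
Definition resolved (r : {poly L}) (c d : L) :=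
  exists2 R, R \in polyOver O & r \Po (d *: 'X + c%:P) = r.[a] *: R.

(** Moving the center within the disc and shrinking the radius amounts to composing [R] with an
    affine polynomial over [O]. *)
Lemma resolved_shift (r : {poly L}) (c d c' d' : L) : d != 0 ->
  (c' - c) / d \in O -> d' / d \in O -> resolved r c d -> resolved r c' d'.
Proof.
move=> d0 Oc Od [R OR rE]; exists (R \Po ((d' / d) *: 'X + ((c' - c) / d)%:P)).
  by rewrite polyOver_comp // rpredD ?polyOverC // polyOverZ ?polyOverX.
rewrite -comp_polyZ -rE comp_affine_affine; congr (_ \Po (_ *: _ + _%:P)).
  by field.
by field.
Qed.

(** Each factor becomes [d (X - e)] with [e] in [M]. *)
Lemma comp_prod_affine (d : L) : d != 0 ->
    {in s, forall b, (b - a) / d \in M} ->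
  exists2 B, B \in polyOver M &
    P \Po (d *: 'X + a%:P) = d ^+ size s *: ('X^(size s) + B).
Proof.
move=> d0; elim: s => [|b t IHt] sM.
  by exists 0; rewrite ?rpred0 // big_nil comp_polyC expr0 scale1r addr0.
have [|B MB PE] := IHt; first by move=> c ct; rewrite sM // inE ct orbT.
pose e := (b - a) / d; have Me : e \in M by rewrite sM ?mem_head.
exists ('X * B - e%:P * ('X^(size t) + B)).
  apply: rpredB; first by rewrite polyOver_maxidMl ?polyOverX.
  rewrite mul_polyC polyOver_maxidZ //.
  by apply: rpredD; [rewrite rpredX ?polyOverX | exact: polyOver_maxidO].
rewrite big_cons comp_polyM PE comp_polyB comp_polyX comp_polyC /= !exprS.
have -> : d *: 'X + a%:P - b%:P = d *: ('X - e%:P).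
  rewrite scalerBr -addrA; congr (_ + _).
  by rewrite -mul_polyC -polyCM -polyCN -polyCD -polyCN; congr (_%:P); rewrite /e; field.
by rewrite -scalerAl -scalerAr scalerA; congr (_ *: _); ring.
Qed.

(** A factorization of a power of [X] modulo [M] has powers of [X] as its factors up to units; the
    sizes decide which power belongs to [h]. *)
Lemma resolved_center (h q r : {poly L}) (m : nat) (c d : L) :
    a \in s -> d != 0 -> (a - c) / d \in O ->
    {in s, forall b, (b - a) / d \in M} ->
    (m.+1 < size s)%N -> m.+1%:R \notin M ->
    h \is monic -> size h = m.+2 -> P = q * h + r -> (size r < size h)%N ->
    resolved r c d -> ~ resolved h c d ->
  (a + h`_m / m.+1%:R) / d \in M.
Proof.
move=> sa d0 Oacd sM ms mM hm sh PE szr rr hr.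
set lin : {poly L} := d *: 'X + a%:P.
have Oca : (c - a) / d \in O by rewrite -opprB mulNr rpredN.
have Odd : d / d \in O by rewrite divff // rpred1.
(* From here on the center is [a] itself, so that constant coefficients are values at [a]. *)
have [R OR rE] : resolved r a d by apply: resolved_shift rr.
have hr' : ~ resolved h a d by move=> ?; apply: hr; apply: (@resolved_shift h a d).
have h0 : h != 0 by rewrite monic_neq0.
have slin : size lin = 2 by rewrite size_affine.
have szP : size P = (size s).+1 by rewrite size_prod_XsubC.
have q0 : q != 0.
  apply: contraTneq szr => q0; have := szP; rewrite PE q0 mul0r add0r => ->.
  by rewrite sh -leqNgt ltnW.
have szq : (size q + m = size s)%N.
  have szqh : size (q * h) = (size q + m.+1)%N by rewrite size_Mmonic // sh addnS.
  have: size P = size (q * h).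
    rewrite PE size_polyDl // szqh (leq_trans szr) // sh -addn1 addnC leq_add2r.
    by rewrite lt0n size_poly_eq0.
  by rewrite szP szqh addnS => -[].
have comp0 g : g != 0 -> g \Po lin != 0 by move=> g0; rewrite comp_poly_eq0 // slin.
have [k k0 /andP[OH MH]] := poly_content O (comp0 h h0).
have [l l0 /andP[OQ MQ]] := poly_content O (comp0 q q0).
set H := k^-1 *: _ in OH MH; set Q := l^-1 *: _ in OQ MQ.
have coef0 g : (g \Po lin)`_0 = g.[a].
  by rewrite -horner_coef0 horner_comp !hornerE.
have Ohk : h.[a] / k \in O.
  by have /polyOverP/(_ 0) := OH; rewrite coefZ coef0 mulrC.
have Oql : q.[a] / l \in O.
  by have /polyOverP/(_ 0) := OQ; rewrite coefZ coef0 mulrC.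
(* If the constant coefficient of [H] were a unit, dividing [H] by it would resolve [h]. *)
have Mhk : h.[a] / k \in M.
  apply/negPn/negP => Mhk; apply: hr'.
  have ha0 : h.[a] != 0.
    by apply: contraNneq Mhk => ->; rewrite mul0r maxid0.
  exists ((k / h.[a]) *: H).
    by rewrite polyOverZ // -invf_div valring_unit.
  rewrite /H !scalerA -[LHS]scale1r; congr (_ *: _).
  by field; rewrite ha0 k0.
have Pa : P.[a] = 0 by apply/rootP; rewrite root_prod_XsubC.
have Mrkl : r.[a] / (k * l) \in M.
  have -> : r.[a] / (k * l) = - (q.[a] / l) * (h.[a] / k).
    have -> : r.[a] = - (q.[a] * h.[a]).
      by apply/eqP; rewrite -addr_eq0 addrC -hornerM -hornerD -PE Pa.
    by field; rewrite k0 l0.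
  by rewrite maxidMl // rpredN.
have [B MB BE] := comp_prod_affine d0 sM.
set t := d ^+ size s / (k * l).
(* This is [P = q h + r] after substitution and division by both contents; the term with [R]
   vanishes modulo [M]. *)
have QHE : Q * H = t *: ('X^(size s) + B) - (r.[a] / (k * l)) *: R.
  have: (k * l)^-1 *: (P \Po lin) = Q * H + (r.[a] / (k * l)) *: R.
    rewrite PE comp_polyD comp_polyM rE scalerDr scalerA; congr (_ + _ *: _).
      by rewrite /Q /H -scalerAl -scalerAr scalerA invfM mulrC.
    exact: mulrC.
  by rewrite BE scalerA mulrC => ->; rewrite addrK.
have MR : (r.[a] / (k * l)) *: R \in polyOver M by rewrite polyOver_maxidZ.
have szB : (B`_(size s) \in M) by apply/polyOverP.
have Ot : t \in O.
  have: (Q * H)`_(size s) \in O by apply/polyOverP; rewrite rpredM.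
  rewrite QHE coefB coefZ coefD coefXn eqxx.
  rewrite rpredBr; last by apply/maxidO/polyOverP.
  have MB1 : 1 + B`_(size s) \notin M by rewrite unitDmaxid ?maxid1.
  have OB1 : 1 + B`_(size s) \in O by rewrite rpredD ?rpred1 // maxidO.
  have B10 : 1 + B`_(size s) != 0 by apply: contraNneq MB1 => ->; apply: maxid0.
  by move=> OtB; rewrite -[t](mulfK B10) rpredM // valring_unit.
have QHM i : i != size s -> (Q * H)`_i \in M.
  move=> iP; rewrite QHE coefB coefZ coefD coefXn (negPf iP) add0r.
  by rewrite rpredB ?maxidMl //; apply/polyOverP.
have [i Hi Hlt] := lowest_unit_coef OH MH.
have [j Qj Qlt] := lowest_unit_coef OQ MQ.
have jis : (j + i)%N = size s.
  apply/eqP; apply: contraTT (lowest_unit_coefM OQ OH Qj Qlt Hi Hlt) => ?.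
  by rewrite negbK QHM.
have szH : size H = m.+2 by rewrite size_scale ?invr_neq0 // size_comp_affine.
have szQ : size Q = size q by rewrite size_scale ?invr_neq0 // size_comp_affine.
have lt_sz A n : A`_n \notin M -> (n < size A)%N.
  by rewrite ltnNge; apply: contra => nA; rewrite nth_default // maxid0.
(* The sizes give [i <= m.+1] and [j <= (size q).-1]; these bounds add up to [size s], so both are
   attained. *)
have im : i = m.+1.
  have := lt_sz _ _ Hi; have := lt_sz _ _ Qj; rewrite szH szQ => ltj lti.
  apply/eqP; rewrite eqn_leq -ltnS lti -(leq_add2l j) jis -szq.
  by rewrite addnS -addSn leq_add2r.
have [Hn Hm] := coef_comp_affine a d0 hm sh.
have: H`_m / H`_m.+1 \in M.
  rewrite maxidMr ?Hlt ?im // valring_unit -?im //; exact/polyOverP.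
rewrite !coefZ Hn Hm => MHH.
have -> : (a + h`_m / m.+1%:R) / d = m.+1%:R^-1 *
    (k^-1 * ((h`_m + m.+1%:R * a) * d ^+ m) / (k^-1 * d ^+ m.+1)).
  rewrite exprS; field; rewrite d0 k0 expf_neq0 //=.
  by apply: contraNneq mM => m0; rewrite -[m.+1]add1n natrD m0 maxid0.
by rewrite maxidMl // valring_unit // rpred_nat.
Qed.

(** Strong induction on the size of [r]: the remainder of [P] by the monic multiple [h] of [r] is
    resolved first, and [resolved_center] is then applied twice. *)
Lemma approximation :
    a \in s -> P \in polyOver 1%VS -> a \notin 1%VS ->
    (forall x : L, x != 0 -> exists d : L, [/\ d \in 1%VS, d != 0, x / d \in O & d / x \in O]) ->
    (forall b c : L, b \in s -> c \in 1%VS -> (b - a) / (a - c) \in M) ->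
    (forall m, (0 < m < size s)%N -> m%:R \notin M) ->
  forall r : {poly L}, r \in polyOver 1%VS -> (size r <= size s)%N ->
  exists c d : L, [/\ c \in 1%VS, d \in 1%VS, d != 0, (a - c) / d \in O & resolved r c d].
Proof.
move=> sa KP Ka eK inertia mM r; have [n] := ubnP (size r).
have aK (c : L) : c \in 1%VS -> a - c != 0.
  by move=> Kc; rewrite subr_eq0; apply: contraNneq Ka => ->.
have dM (c d : L) : c \in 1%VS -> (a - c) / d \in O -> {in s, forall b, (b - a) / d \in M}.
  move=> Kc Oacd b sb.
  have -> : (b - a) / d = (b - a) / (a - c) * ((a - c) / d).
    by rewrite mulrA divfK // aK.
  by rewrite maxidMr // inertia.
elim: n r => // n IHn r; rewrite ltnS => szr Kr szrs.
(* A constant is resolved by [R = 1] at any center, here 0. *)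
have [szr1|] := leqP (size r) 1.
  have [d [Kd d0 Oad _]] := eK (a - 0) (aK 0 (mem0v _)).
  exists 0, d; split=> //; first exact: mem0v.
  exists 1; first exact: rpred1.
  by rewrite (size1_polyC szr1) comp_polyC hornerC alg_polyC.
case E: (size r) => [|[|m]] // _.
have r0 : r != 0 by rewrite -size_poly_gt0 E.
set h : {poly L} := (lead_coef r)^-1 *: r.
have lr0 : lead_coef r != 0 by rewrite lead_coef_eq0.
have hm : h \is monic by rewrite monicE lead_coefZ mulVf.
have sh : size h = m.+2 by rewrite size_scale ?invr_neq0.
have Kh : h \in polyOver 1%VS.
  apply/polyOverP => i; rewrite coefZ; have /polyOverP Kri := Kr.
  by apply: rpredM; rewrite ?memvV ?lead_coefE; apply: Kri.
have hr c d : resolved h c d -> resolved r c d.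
  case=> R OR hE; exists R => //; have -> : r = lead_coef r *: h.
    by rewrite scalerA divff // scale1r.
  by rewrite comp_polyZ hE hornerZ scalerA.
apply: NNPP => noh.
have bad (c d : L) : c \in 1%VS -> d \in 1%VS -> d != 0 -> (a - c) / d \in O ->
  ~ resolved h c d by move=> ? ? ? ? /hr ?; apply: noh; exists c, d.
have szrem : (size (P %% h)%R < size h)%N by rewrite ltn_modp monic_neq0.
have [||c [d [Kc Kd d0 Oacd rr]]] := IHn _ _ (modp_polyOver KP Kh).
- by rewrite (leq_trans szrem) // sh -E.
- by rewrite (leq_trans (ltnW szrem)) // sh -E.
have m1 : m.+1%:R \notin M by rewrite mM //= -ltnS -E ltnS.
have S (c' d' : L) : c' \in 1%VS -> d' \in 1%VS -> d' != 0 ->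
    (a - c') / d' \in O -> resolved (P %% h) c' d' -> (a + h`_m / m.+1%:R) / d' \in M.
  move=> Kc' Kd' d0' Oacd' rr'; apply: (@resolved_center h (P %/ h) (P %% h) m c' d') => //.
  - exact: (dM c').
  - by rewrite -ltnS -E ltnS.
  - exact: divp_eq.
  - exact: bad.
set c' : L := - (h`_m / m.+1%:R).
have Kc' : c' \in 1%VS.
  by rewrite rpredN rpredM ?memvV ?rpred_nat //; apply/polyOverP.
have Macd : (a - c') / d \in M by rewrite opprK (S c).
(* With the center [c'] and a radius [d'] of the same value as [a - c'], a second application puts
   the unit [(a - c') / d'] in [M]. *)
have [d' [Kd' d0' Oacd' Od']] := eK _ (aK _ Kc').
have: (a - c') / d' \in M.
  rewrite {1}opprK; apply: (S c') => //; apply: resolved_shift rr => //.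
    have -> : (c' - c) / d = (a - c) / d - (a - c') / d by ring.
    by rewrite rpredB // maxidO.
  have -> : d' / d = (d' / (a - c')) * ((a - c') / d) by rewrite mulrA divfK // aK.
  by rewrite rpredM // maxidO.
move=> /(maxidMl Od'); rewrite mulrA divfK ?aK // divff //.
by rewrite (negPf (maxid1 O)).
Qed.
End Approximation.

(** * Ordered abelian groups *)

Section OrderedGroupTheory.
Variables (Γ : zmodType) (le : rel Γ).
Hypothesis ogle : ordered_abelian_group le.
Implicit Types x y z : Γ.

Lemma og_refl x : le x x.
Proof. by case: ogle. Qed.

Lemma og_trans y x z : le x y -> le y z -> le x z.
Proof. by case: ogle => _ tr _ _ _; apply: tr. Qed.

Lemma og_anti x y : le x y -> le y x -> x = y.
Proof. by case: ogle => _ _ an _ _ xy yx; apply: an; rewrite xy. Qed.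

Lemma og_total x y : le x y || le y x.
Proof. by case: ogle. Qed.

Lemma og_addr z x y : le (x + z) (y + z) = le x y.
Proof.
case: ogle => _ _ _ _ mono; apply/idP/idP; last exact: mono.
by move/mono => /(_ (- z)); rewrite !addrK.
Qed.

Lemma og_subr_ge0 x y : le 0 (x - y) = le y x.
Proof. by rewrite -(og_addr y) add0r subrK. Qed.

Lemma og_opp x y : le (- x) (- y) = le y x.
Proof. by rewrite -(og_addr x) -(og_addr y) addNr add0r addrAC addNr add0r. Qed.

Lemma glt_nle x y : glt le x y = ~~ le y x.
Proof.
rewrite /glt; apply/andP/idP => [[xy nxy]|yx].
  by apply: contraNN nxy => yx; rewrite (og_anti xy yx).
have xy : le x y by have := og_total x y; rewrite (negPf yx) orbF.
by split=> //; apply: contraNneq yx => ->; apply: og_refl.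
Qed.

Lemma glt_subr_gt0 x y : glt le 0 (x - y) = glt le y x.
Proof. by rewrite !glt_nle -(og_addr y) subrK add0r. Qed.
End OrderedGroupTheory.

(** * The valuation ring of a valuation *)

Section ValuationTheory.
Variables (Γ : zmodType) (le : rel Γ) (F : fieldType) (v : F -> option Γ).
Hypothesis (ogle : ordered_abelian_group le) (valv : is_valuation le v).
Implicit Types (x y : F) (g h : Γ).

Lemma val_zero : v 0 = None.
Proof. by case: valv => v0 _ _; apply/v0. Qed.

Lemma val_neq0 x g : v x = Some g -> x != 0.
Proof. by move=> vx; apply/eqP => x0; move: vx; rewrite x0 val_zero. Qed.

Lemma val_mul x y : v (x * y) = oadd (v x) (v y).
Proof. by case: valv. Qed.

Lemma val_some x : x != 0 -> exists g, v x = Some g.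
Proof.
move=> /eqP x0; case: valv => v0 _ _; case E: (v x) => [g|]; first by exists g.
by case: x0; apply/v0.
Qed.

Lemma val_one : v 1 = Some 0.
Proof.
have [g vg] := val_some (oner_neq0 F); have := val_mul 1 1; rewrite mulr1 vg /=.
by case=> /esym/eqP; rewrite -[X in _ == X]addr0 (inj_eq (addrI g)) => /eqP->.
Qed.

Lemma val_inv x g : v x = Some g -> v x^-1 = Some (- g).
Proof.
move=> vx; have x0 := val_neq0 vx; have [h vh] := val_some (invr_neq0 x0).
have := val_mul x x^-1; rewrite mulfV // val_one vx vh => -[] /eqP.
by rewrite eq_sym addrC addr_eq0 => /eqP->.
Qed.

Lemma val_div x y g h : v x = Some g -> v y = Some h -> v (x / y) = Some (g - h).
Proof. by move=> vx vy; rewrite val_mul vx (val_inv vy). Qed.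

Definition valO_pred : {pred F} := [pred x | oleq le (Some 0) (v x)].

Fact valO_ring : subring_closed valO_pred.
Proof.
(* Twice the value of -1 is 0, and an ordered group has no torsion. *)
have valN1 : v (- 1) = Some 0.
  have N10 : -1 != 0 :> F by rewrite oppr_eq0 oner_neq0.
  have [g vg] := val_some N10; have := val_mul (-1) (-1).
  rewrite mulrNN mulr1 val_one vg => -[gg].
  have [g0|g0] := orP (og_total ogle 0 g).
    suff -> : g = 0 by []; apply: (og_anti ogle) => //.
    by rewrite -(og_addr ogle g) -gg add0r.
  suff -> : g = 0 by []; apply: (og_anti ogle) => //.
  by rewrite -(og_addr ogle g) -gg add0r.
split=> [|x y|x y]; rewrite !inE.
- by rewrite val_one /= og_refl.
- move=> vx vy; case: valv => _ _ -> //; rewrite -mulN1r val_mul valN1.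
  by case: (v y) vy => //= g; rewrite add0r.
rewrite val_mul; case: (v x) (v y) => [g|] [h|] //= g0 h0.
by apply: (og_trans ogle h0); rewrite -{1}[h]add0r og_addr.
Qed.

Fact valO_val x : x != 0 -> (x \in valO_pred) || (x^-1 \in valO_pred).
Proof.
move=> /val_some[g vg]; rewrite !inE (val_inv vg) vg /=.
by rewrite -[X in _ || le X _]oppr0 og_opp // og_total.
Qed.

Definition valO : valring F := ValRing valO_ring valO_val.

Lemma in_valO x : (x \in valO) = oleq le (Some 0) (v x).
Proof. by []. Qed.

Lemma in_valM x : (x \in maxid valO) = opos le (v x).
Proof.
have [->|x0] := eqVneq x 0; first by rewrite maxid0 val_zero.
have [g vg] := val_some x0; rewrite maxidV // in_valO (val_inv vg) vg /=.
by rewrite -[X in le X]oppr0 og_opp // glt_nle.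
Qed.

Lemma valO_div x y g h : v x = Some g -> v y = Some h -> (x / y \in valO) = le h g.
Proof. by move=> vx vy; rewrite in_valO (val_div vx vy) /= og_subr_ge0. Qed.

Lemma valM_div x y g h :
  v x = Some g -> v y = Some h -> (x / y \in maxid valO) = glt le h g.
Proof. by move=> vx vy; rewrite in_valM (val_div vx vy) /= glt_subr_gt0. Qed.

Lemma val_eq x y : x != 0 -> y != 0 ->
  x / y \in valO -> y / x \in valO -> v x = v y.
Proof.
move=> /val_some[g vg] /val_some[h vh]; rewrite (valO_div vg vh) (valO_div vh vg).
by move=> hg gh; rewrite vg vh (og_anti ogle hg gh).
Qed.

Lemma valD_lt x y g : v x = Some g -> y / x \in maxid valO -> v (x + y) = Some g.
Proof.
move=> vx Myx; have x0 := val_neq0 vx.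
have M1 : 1 + y / x \notin maxid valO by rewrite unitDmaxid ?maxid1.
have O1 : 1 + y / x \in valO by rewrite rpredD ?rpred1 // maxidO.
have -> : x + y = x * (1 + y / x) by field.
have [|h vh] := @val_some (1 + y / x).
  by apply: contraNneq M1 => ->; apply: maxid0.
move: O1 M1; rewrite in_valO in_valM vh /= glt_nle // negbK => h0 h0'.
by rewrite val_mul vx vh /= (og_anti ogle h0' h0) addr0.
Qed.

Lemma val_exp x g n : v x = Some g -> v (x ^+ n) = Some (g *+ n).
Proof.
by move=> vx; elim: n => [|n IHn]; rewrite ?expr0 ?val_one // exprS val_mul vx IHn mulrS.
Qed.

Lemma val_unit x : x \in valO -> x \notin maxid valO -> v x = Some 0.
Proof.
rewrite in_valO in_valM; case: (v x) => [g|] //=; rewrite glt_nle // negbK.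
by move=> g0 g0'; rewrite (og_anti ogle g0 g0').
Qed.
End ValuationTheory.

(** * Galois invariance of the valuation and the value group *)

Section GaloisDefect.
Variables (p : nat) (K : fieldType) (L : splittingFieldType K).
Variables (Γ : zmodType) (le : rel Γ) (v : L -> option Γ).
Hypotheses (ogle : ordered_abelian_group le) (valv : is_valuation le v).
Hypotheses (p_pr : prime p) (dimL : \dim {:L} = p) (galL : galois 1%VS {:L}).
Hypotheses (uniqv : unique_extension le v) (defect : nontrivial_defect le v).

Local Notation G := 'Gal({:L} / 1%VS)%g.
Local Notation O := (valO ogle valv).
Local Notation M := (maxid O).
Implicit Types (x y : L) (s t : gal_of {:L}).

Lemma mem1P x : reflect (exists c : K, x = c%:A) (x \in 1%VS).
Proof. exact: vlineP. Qed.

Lemma mem1A (c : K) : c%:A \in (1%VS : {vspace L}).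
Proof. by apply/mem1P; exists c. Qed.

Lemma galA s (c : K) : s c%:A = c%:A.
Proof. by rewrite linearZ /= rmorph1. Qed.

Lemma gal_mem1 s x : x \in 1%VS -> s x = x.
Proof. by case/mem1P=> c ->; apply: galA. Qed.

Lemma galMx s t x : (s * t)%g x = t (s x).
Proof. by rewrite galM ?memvf. Qed.

Lemma galVK s x : s (s^-1%g x) = x.
Proof. by rewrite -galMx mulVg gal_id. Qed.

Lemma gal_fixed x : (forall s, s \in G -> s x = x) -> x \in 1%VS.
Proof.
move=> fx; have /galois_fixedField <- := galL.
by apply/fixedFieldP; rewrite ?memvf.
Qed.

Lemma card_gal : #|G| = p.
Proof. by rewrite -galois_dim // dimv1 divn1. Qed.

Lemma mem_cycle_gal s t : s \in G -> s != 1%g -> t \in G -> t \in <[s]>%g.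
Proof.
move=> Gs s1 Gt; suff -> : <[s]>%g = G by [].
apply/eqP; rewrite eqEcard cycle_subG Gs /= card_gal -orderE.
have := order_dvdG Gs; rewrite card_gal => /(prime_nt_dvdP p_pr) -> //.
by rewrite order_eq1.
Qed.

(** The preimage of [O] under [s] is a valuation ring with the same trace on [K], so uniqueness
    identifies it with [O]. *)
Lemma galO s x : (s x \in O) = (x \in O).
Proof.
have vrs : is_valuation_ring (fun x : L => vring le v (s x)).
  split; rewrite /vring.
  - by rewrite rmorph1 (val_one valv) /= og_refl.
  - by move=> y z; rewrite rmorphB; apply: rpredB O _ _.
  - by move=> y z; rewrite rmorphM; apply: rpredM O _ _.
  move=> y y0; rewrite fmorphV; apply/orP; apply: (vr_val O).
  by rewrite fmorph_eq0.
have [//|ox xo] := uniqv vrs _ x; first by move=> c; rewrite galA.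
by apply/idP/idP; [apply: ox | apply: xo].
Qed.

Lemma galMid s x : (s x \in M) = (x \in M).
Proof. by rewrite !maxidE galO -fmorphV galO fmorph_eq0. Qed.

Lemma gal_divO s x : x != 0 -> s x / x \in O.
Proof.
move=> x0; apply/negPn/negP => /notin_valring; rewrite invf_div => Mx.
(* The quotients telescope; at the order of [s] the quotient is 1, which is not in [M]. *)
have Mn n : x / (s ^+ n.+1)%g x \in M.
  elim: n => [|n IHn]; first by rewrite expg1.
  have -> : x / (s ^+ n.+2)%g x = (x / s x) * s (x / (s ^+ n.+1)%g x).
    by rewrite expgSr galMx rmorphM fmorphV mulrA divfK // fmorph_eq0.
  by rewrite maxidMl ?galMid // maxidO.
have := Mn #[s]%g.-1; rewrite prednK ?order_gt0 // expg_order gal_id divff //.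
by rewrite (negPf (maxid1 O)).
Qed.

Lemma val_gal s x : v (s x) = v x.
Proof.
have [->|x0] := eqVneq x 0; first by rewrite rmorph0.
apply: (@val_eq _ _ _ _ ogle valv); rewrite ?fmorph_eq0 ?gal_divO //.
by rewrite -{1}[x](galVK s) -fmorph_div galO gal_divO.
Qed.

Lemma valgroupKD g h : valgroupK v g -> valgroupK v h -> valgroupK v (g + h).
Proof.
move=> [c [c0 vc]] [d [d0 vd]]; exists (c * d); rewrite mulf_neq0 //; split=> //.
by rewrite -in_algE rmorphM (val_mul valv) vc vd.
Qed.

Lemma valgroupKN g : valgroupK v g -> valgroupK v (- g).
Proof.
move=> [c [c0 vc]]; exists c^-1; rewrite invr_neq0 //; split=> //.
by rewrite -in_algE fmorphV (val_inv valv vc).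
Qed.

Lemma valgroupK0 : valgroupK v 0.
Proof. by exists 1; rewrite oner_neq0 scale1r (val_one valv). Qed.

Lemma valgroupKMn g n : valgroupK v g -> valgroupK v (g *+ n).
Proof.
move=> Kg; elim: n => [|n IHn]; first exact: valgroupK0.
by rewrite mulrS; apply: valgroupKD.
Qed.

Lemma valgroupK_mem1 x g : x \in 1%VS -> v x = Some g -> valgroupK v g.
Proof.
move=> /mem1P[c ->] vc; exists c; split=> //.
by apply: contraNneq (val_neq0 valv vc) => ->; rewrite scale0r.
Qed.

Lemma valgroupK_norm x g : v x = Some g -> valgroupK v (g *+ p).
Proof.
move=> vx; have Nx := mem_galNorm galL (memvf x).
apply: (valgroupK_mem1 Nx); rewrite /galNorm -card_gal -sum1_card.
by elim/big_rec2: _ => [|s n y _ vy]; rewrite ?(val_one valv) // (val_mul valv) val_gal vx vy mulrS.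
Qed.

Lemma res_at_least1 : res_at_least le v 1.
Proof.
exists (fun=> 1); split=> [_|c Oc]; first by rewrite /vring (val_one valv) /= og_refl.
by rewrite big_ord1 mulr1 => c0 i; rewrite (ord1 i).
Qed.

(** If [g] were outside [vK], the multiples of [g] by [0, ..., p - 1] would be distinct modulo [vK],
    since [g *+ p] is the value of a norm; then [e >= p] and [f >= 1] contradict the defect. *)
Lemma valgroup_eq g : valgroupL v g -> valgroupK v g.
Proof.
move=> [x [x0 vx]]; apply: NNPP => nKg; apply: defect.
exists p, 1%N; rewrite dimL muln1; split=> //; split; last exact: res_at_least1.
exists (fun i : 'I_p => x ^+ i); split=> [i|]; first by rewrite expf_neq0.
have noK k : (0 < k < p)%N -> ~ valgroupK v (g *+ k).
  case/andP=> k0 kp Kk; apply: nKg.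
  have cop : coprime k p by rewrite coprime_sym prime_coprime // gtnNdvd.
  (* By Bezout [w * k = 1 + u * p], so [g] is a combination of [g *+ k] and [g *+ p]. *)
  have [u _ /dvdnP[w uE]] := Bezoutl p k0.
  have -> : g = (g *+ k) *+ w - (g *+ p) *+ u.
    rewrite -!mulrnA; move: cop; rewrite /coprime => /eqP gkp.
    by rewrite [(k * w)%N]mulnC -uE gkp mulrnDr mulr1n [(p * u)%N]mulnC addrK.
  apply: valgroupKD; first exact: valgroupKMn.
  by apply/valgroupKN/valgroupKMn/(valgroupK_norm vx).
move=> i j gi gj; wlog ij : i j gi gj / (j < i)%N.
  move=> IH; have [ij|ij|/val_inj->] := ltngtP i j; last by rewrite eqxx.
    rewrite eq_sym => nij vi vj /valgroupKN; rewrite opprB.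
    exact: (IH j i gj gi ij nij vj vi).
  exact: IH.
rewrite !(val_exp valv _ vx) => _ -[<-] [<-]; rewrite -mulrnBr 1?ltnW //.
by apply: noK; rewrite subn_gt0 ij (leq_ltn_trans (leq_subr _ _)).
Qed.

Lemma exists_mem1_val x g : v x = Some g -> exists d, [/\ d \in 1%VS, d != 0 & v d = Some g].
Proof.
move=> vx; have [|c [c0 vc]] := @valgroup_eq g; first by exists x; rewrite (val_neq0 valv vx).
by exists c%:A; rewrite mem1A (val_neq0 valv vc).
Qed.

Lemma exists_mem1_sim x : x != 0 ->
  exists d : L, [/\ d \in 1%VS, d != 0, x / d \in O & d / x \in O].
Proof.
move=> /(val_some valv)[g vx]; have [d [Kd d0 vd]] := exists_mem1_val vx.
by exists d; rewrite (valO_div _ _ vx vd) (valO_div _ _ vd vx) og_refl.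
Qed.

(** * Residues, inertia and the value of [p] *)

Lemma res_at_least_powers y : y \in O ->
    (forall A, A \in polyOver 1%VS -> A \in polyOver O -> (size A <= p)%N ->
       A.[y] \in M -> A \in polyOver M) ->
  res_at_least le v p.
Proof.
move=> Oy indep; exists (fun i => y ^+ i); split=> [i|c Oc]; first exact: rpredX O _ _ _.
(* The family [c] is extended by 0 to all indices, so that it becomes the coefficients of a
   polynomial. *)
pose E i := oapp (fun j : 'I_p => (c j)%:A : L) 0 (insub i).
have Ei (i : 'I_p) : E i = (c i)%:A by rewrite /E valK.
pose A := \poly_(i < p) E i.
have AE : \sum_i (c i)%:A * y ^+ i = A.[y].
  by rewrite horner_poly; apply: eq_bigr => i _; rewrite Ei.
rewrite AE -(in_valM ogle valv) => MA i.
have coefA k : A`_k = E k.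
  by rewrite coef_poly; case: ifP => // kp; rewrite /E insubN ?kp.
suff /polyOverP/(_ i) : A \in polyOver M by rewrite coefA Ei in_valM.
apply: indep => //; last exact: size_poly.
  apply/polyOverP => k; rewrite coefA /E; case: insub => [j|] /=; [exact: mem1A|exact: mem0v].
by apply/polyOverP => k; rewrite coefA /E; case: insub => [j|]; [exact: Oc|exact: rpred0].
Qed.

Lemma no_res_at_least : ~ res_at_least le v p.
Proof.
move=> resp; apply: defect; exists 1%N, p; rewrite dimL mul1n; split=> //; split=> //.
exists (fun=> 1); split=> [_|i j]; first exact: oner_neq0.
by rewrite (ord1 i) (ord1 j).
Qed.

Lemma gal_telescope s x n : s x - x \in M -> (s ^+ n)%g x - x \in M.
Proof.
move=> Msx; elim: n => [|n IHn]; first by rewrite expg0 gal_id subrr maxid0.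
have -> : (s ^+ n.+1)%g x - x = s ((s ^+ n)%g x - x) + (s x - x).
  by rewrite expgSr galMx rmorphB addrA subrK.
by rewrite rpredD // galMid.
Qed.

Lemma horner_gal s (A : {poly L}) x :
  A \in polyOver 1%VS -> A.[s x] = s A.[x].
Proof.
move=> /polyOverP KA; rewrite !horner_coef rmorph_sum; apply: eq_bigr => i _.
by rewrite rmorphM rmorphXn /= (gal_mem1 _ (KA i)).
Qed.

Definition conjs x := [seq s x | s : gal_of {:L} <- enum G].

Lemma size_conjs x : size (conjs x) = p.
Proof. by rewrite size_map -cardE card_gal. Qed.

Lemma mem_conjs x : x \in conjs x.
Proof. by apply/mapP; exists 1%g; rewrite ?mem_enum ?group1 ?gal_id. Qed.

Lemma inertia s x : s \in G -> x != 0 -> (s x - x) / x \in M.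
Proof.
move=> Gs x0; apply/negPn/negP => nM; apply: no_res_at_least.
(* Since [vL = vK], dividing by an element of [K] reduces to a unit [y]. *)
have [d [Kd d0 Oxd Odx]] := exists_mem1_sim x0.
pose y := x / d; have y0 : y != 0 by rewrite mulf_neq0 ?invr_neq0.
(* If some [t != 1] moved [y] only within [M], so would its power [s], against the assumption on
   [x]. *)
have nMy t : t \in G -> t != 1%g -> t y - y \notin M.
  move=> Gt t1; apply: contra nM => Mty.
  have /cycleP[n sE] := mem_cycle_gal Gt t1 Gs.
  have := gal_telescope n Mty; rewrite -sE => Msy.
  have -> : (s x - x) / x = (s y - y) * (d / x).
    rewrite /y fmorph_div /= (gal_mem1 s Kd); field.
    by rewrite x0 d0.
  exact: maxidMr.
apply: (@res_at_least_powers y) => // A KA OA szA MA.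
(* [A] has its coefficients in [K], so it vanishes modulo [M] at all [p] conjugates of [y], which
   are distinct modulo [M]. *)
apply: (@polyOver_maxid_roots _ O (conjs y)); rewrite ?size_conjs //.
- by move=> z /mapP[t _ ->]; rewrite galO.
- rewrite /conjs pairwise_map; have := enum_uniq G; rewrite uniq_pairwise.
  apply: (@sub_in_pairwise _ (mem G)) => [t u Gt Gu /= ntu|].
    have -> : t y - u y = u ((t * u^-1)%g y - y) by rewrite rmorphB /= galMx galVK.
    by rewrite galMid nMy ?groupM ?groupV // -eq_mulgV1.
  by apply/allP => t; rewrite mem_enum.
by move=> z /mapP[t _ ->]; rewrite horner_gal // galMid.
Qed.


Lemma p_maxid : p%:R \in M.
Proof.
apply/negPn/negP => nMp.
have p0 : p%:R != 0 :> L by apply: contraNneq nMp => ->; apply: maxid0.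
have [a Ka] : exists a : L, a \notin 1%VS.
  apply: NNPP => noa; have := prime_gt1 p_pr; rewrite -dimL ltnNge.
  rewrite -[X in (_ <= X)%N](dimv1 L) dimvS //; apply/subvP => a _; apply/negPn/negP => Ka.
  by apply: noa; exists a.
pose Tr x := \sum_(s in G) s x.
have KTr x : Tr x \in 1%VS.
  exact: mem_galTrace galL (memvf x).
pose x := a - Tr a / p%:R.
have x0 : x != 0.
  rewrite subr_eq0; apply: contraNneq Ka => ->.
  by rewrite rpredM ?KTr // memvV rpred_nat.
have Trx : Tr x = 0.
  rewrite /Tr /x; under eq_bigr do rewrite rmorphB /= fmorph_div rmorph_nat /= (gal_mem1 _ (KTr a)).
  by rewrite sumrB sumr_const card_gal -[X in _ - X]mulr_natr divfK // subrr.
have : Tr x / x = p%:R + \sum_(s in G) (s x - x) / x.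
  rewrite mulr_suml -card_gal -sumr_const -big_split; apply: eq_bigr => s _ /=.
  by field.
rewrite Trx mul0r => /eqP; rewrite eq_sym addr_eq0 => /eqP pE.
case/negP: nMp; rewrite pE rpredN rpred_sum // => s Gs; exact: inertia.
Qed.

Lemma natr_unit m : (0 < m < p)%N -> m%:R \notin M.
Proof.
case/andP=> m0 mp; have [u _ /dvdnP[w uE]] := Bezoutl p m0.
have cop : coprime m p by rewrite coprime_sym prime_coprime // gtnNdvd.
apply: contra (maxid1 O) => Mm.
have : (gcdn m p + u * p)%:R \in M by rewrite uE natrM maxidMl // rpred_nat.
rewrite (eqP cop) natrD natrM rpredDr // maxidMl ?rpred_nat //; exact: p_maxid.
Qed.

(** * Approximation by elements of [K] and immediacy *)

Lemma prod_conjs_mem1 x : \prod_(y <- conjs x) ('X - y%:P) \in polyOver 1%VS.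
Proof.
set P := \prod_(y <- _) _; have PE : P = \prod_(s in G) ('X - (s x)%:P).
  by rewrite /P big_map big_enum.
apply/polyOverP => i; apply: gal_fixed => s Gs.
have mapP : map_poly s P = P.
  rewrite PE rmorph_prod [RHS](reindex_acts 'R _ Gs) ?astabsR //=.
  by apply: eq_bigr => t _; rewrite rmorphB /= map_polyX map_polyC /= -galMx.
by rewrite -{2}mapP coef_map.
Qed.

Lemma conjs_inertia a b c : a \notin 1%VS -> b \in conjs a -> c \in 1%VS ->
  (b - a) / (a - c) \in M.
Proof.
move=> Ka /mapP[s]; rewrite mem_enum => Gs -> Kc.
have ac0 : a - c != 0 by rewrite subr_eq0; apply: contraNneq Ka => ->.
have -> : s a - a = s (a - c) - (a - c) by rewrite rmorphB /= (gal_mem1 s Kc); ring.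
exact: inertia.
Qed.

Lemma gal_approximation a r :
    a \notin 1%VS -> r \in polyOver 1%VS -> (size r <= p)%N ->
  exists c d : L, [/\ c \in 1%VS, d \in 1%VS, d != 0, (a - c) / d \in O & resolved O a r c d].
Proof.
move=> Ka Kr szr; apply: (@approximation _ _ O a (conjs a)) => //.
- exact: mem_conjs.
- exact: prod_conjs_mem1.
- exact: exists_mem1_sim.
- by move=> b c; apply: conjs_inertia.
- by rewrite size_conjs; exact: natr_unit.
- by rewrite size_conjs.
Qed.

(** This combines [vL = vK] and [Lv = Kv]. If it failed, a unit multiple [z] of [y] would have a
    residue outside [Kv], and resolving polynomials at [z] would make its first [p] powers
    independent over [Kv]. *)
Lemma immediate y : y != 0 -> exists2 c, c \in 1%VS & (y - c) / y \in M.
Proof.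
move=> y0; apply: NNPP => noc; apply: no_res_at_least.
have [d [Kd d0 Oyd Ody]] := exists_mem1_sim y0; pose z := y / d.
have zM c : c \in 1%VS -> z - c \notin M.
  move=> Kc; apply/negP => Mzc; apply: noc; exists (c * d); first exact: rpredM.
  have -> : (y - c * d) / y = (z - c) * (d / y) by rewrite /z; field; rewrite d0 y0.
  exact: maxidMr.
have Kz : z \notin 1%VS by apply/negP => /zM; rewrite subrr maxid0.
apply: (@res_at_least_powers z) => // A KA OA szA MA.
have [c [e [Kc Ke e0 Oze rA]]] := gal_approximation Kz KA szA.
have zc0 : z - c != 0 by apply: contraNneq (zM c Kc) => ->; apply: maxid0.
have Ozc : (z - c)^-1 \in O.
  have [Oz|/notin_valring/maxidO//] := boolP (z - c \in O).
  by rewrite valring_unit // zM.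
(* As [z - c] is not in [M], the disc of center [c] and radius [e] contains the one of center 0 and
   radius 1; there [A] equals [A.[z]] times a polynomial over [O]. *)
have Oe : 1 / e \in O.
  have -> : 1 / e = (z - c)^-1 * ((z - c) / e) by rewrite mulrA mulVf.
  exact: rpredM.
have [|R OR] := @resolved_shift _ _ O z A c e 0 1 e0 _ Oe rA.
  have -> : (0 - c) / e = (z - c) / e - z * (1 / e) by ring.
  by rewrite rpredB // rpredM.
by rewrite scale1r addr0 comp_polyXr => ->; rewrite polyOver_maxidZ.
Qed.


(** * The set [Sigma v s] and its independence of the generator *)

Lemma Sigma_intro s f g : v ((s f - f) / f) = Some g -> Sigma v s g.
Proof.
move=> vf; have := val_neq0 valv vf; rewrite mulf_eq0 negb_or invr_eq0 subr_eq0.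
by case/andP=> sf f0; exists f.
Qed.

Lemma val_valgroupK x g : v x = Some g -> valgroupK v g.
Proof. by move=> vx; apply: valgroup_eq; exists x; rewrite (val_neq0 valv vx). Qed.

Lemma valgroupK_L g : valgroupK v g -> valgroupL v g.
Proof. by case=> c [_ vc]; exists c%:A; rewrite (val_neq0 valv vc). Qed.

Lemma Sigma_gt0 s g : s \in G -> Sigma v s g -> valgroupK v g /\ glt le 0 g.
Proof.
move=> Gs [f [f0 _ vf]]; split; first exact: val_valgroupK vf.
by have := inertia Gs f0; rewrite in_valM vf.
Qed.

(** Scale [f] to a unit, multiply it by an element of [K] of value [h - g > 0] and add 1: the new
    element has value 0 and its difference under [s] has value [h]. *)
Lemma Sigma_up s g h : Sigma v s g -> valgroupK v h -> le g h -> Sigma v s h.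
Proof.
move=> Sg Kh gh; have [<-//|ngh] := eqVneq g h.
case: Sg => f [f0 sf vg]; have [gf vf] := val_some valv f0.
have [d [Kd d0 vd]] := exists_mem1_val vf.
have [c0 [_ vc]] := valgroupKD Kh (valgroupKN (val_valgroupK vg)).
pose c := c0%:A : L; have sc : s c = c by apply: galA.
have sd := gal_mem1 s Kd.
have vcf : v (c * (f / d)) = Some (h - g).
  by rewrite (val_mul valv) vc (val_div valv vf vd) /= subrr addr0.
have vf' : v (1 + c * (f / d)) = Some 0.
  apply: (@valD_lt _ _ _ _ ogle valv); rewrite ?(val_one valv) // divr1.
  by rewrite in_valM vcf /= glt_subr_gt0 // /glt gh ngh.
apply: (@Sigma_intro s (1 + c * (f / d))).
have -> : s (1 + c * (f / d)) - (1 + c * (f / d)) = c * (f / d) * ((s f - f) / f).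
  rewrite rmorphD rmorphM rmorph1 fmorph_div /= sc sd; field.
  by rewrite f0 d0.
have vn : v (c * (f / d) * ((s f - f) / f)) = Some h.
  by rewrite (val_mul valv) vcf vg /= subrK.
by rewrite (val_div valv vn vf') subr0.
Qed.

(** The numerator is the sum of the first [n] conjugates of [s f - f] under powers of [s]. *)
Lemma gal_telescope_div s f n : s f != f -> ((s ^+ n)%g f - f) / (s f - f) \in O.
Proof.
rewrite -subr_eq0 => sf0; elim: n => [|n IHn].
  by rewrite expg0 gal_id subrr mul0r rpred0.
set w := (s ^+ n)%g f - f in IHn *.
have -> : ((s ^+ n.+1)%g f - f) / (s f - f)
    = s (w / (s f - f)) * (s (s f - f) / (s f - f)) + 1.
  have -> : (s ^+ n.+1)%g f - f = s w + (s f - f).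
    by rewrite expgSr galMx rmorphB addrA subrK.
  rewrite mulrDl divff // fmorph_div mulrA divfK //.
  by rewrite fmorph_eq0.
by rewrite rpredD ?rpred1 // rpredM ?galO // gal_divO.
Qed.

(** The same [f] gives for [s] a value at most [g], and the set is closed upwards. *)
Lemma Sigma_pow s n g : Sigma v (s ^+ n)%g g -> Sigma v s g.
Proof.
case=> f [f0 tf vg].
have sf : s f != f.
  apply: contraNneq tf => sf; elim: n {vg} => [|n IHn]; first by rewrite expg0 gal_id.
  by rewrite expgSr galMx (eqP IHn) sf.
have sff0 : (s f - f) / f != 0 by rewrite mulf_neq0 ?invr_neq0 // subr_eq0.
have [h vh] := val_some valv sff0.
apply: (@Sigma_up s h); [exact: Sigma_intro vh | exact: val_valgroupK vg |].
rewrite -(valO_div ogle valv vg vh) invf_div mulrA divfK //.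
exact: gal_telescope_div.
Qed.

Lemma Sigma_gen s t g :
  s \in G -> s != 1%g -> t \in G -> t != 1%g -> Sigma v s g <-> Sigma v t g.
Proof.
move=> Gs s1 Gt t1; have /cycleP[i sE] := mem_cycle_gal Gt t1 Gs.
have /cycleP[j tE] := mem_cycle_gal Gs s1 Gt.
by split=> [|]; [rewrite sE | rewrite tE]; apply: Sigma_pow.
Qed.

(** Replacing [f] by [f - c], with [c] in [K] and [v (f - c) > v f], keeps the numerator and
    enlarges the value of the denominator. *)
Lemma Sigma_no_min s g : Sigma v s g -> exists2 h, Sigma v s h & glt le h g.
Proof.
case=> f [f0 sf vg]; have [c Kc Mfc] := immediate f0.
have sc := gal_mem1 s Kc.
have fc0 : f - c != 0.
  by rewrite subr_eq0; apply: contraNneq sf => ->; rewrite sc.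
have [h vh] := val_some valv (mulf_neq0 fc0 (invr_neq0 f0)).
exists (g - h).
  apply: (@Sigma_intro s (f - c)); rewrite -(val_div valv vg vh); congr v.
  by rewrite rmorphB /= sc; field; rewrite f0 fc0.
rewrite -glt_subr_gt0 // opprB addrCA subrr addr0.
by move: Mfc; rewrite in_valM vh.
Qed.

(** * Ramification segments and ramification ideals *)

Section Segments.
Variable s : gal_of {:L}.
Hypotheses (Gs : s \in G) (s1 : s != 1%g).

Lemma ideal_of_Sigma t f : t \in G -> f != 0 -> ideal_of v (Sigma v s) ((t f - f) / f).
Proof.
move=> Gt f0; have [->|tf0] := eqVneq ((t f - f) / f) 0; first by left.
have [g vg] := val_some valv tf0; right; exists g; split=> //.
have t1 : t != 1%g.
  by apply: contraNneq tf0 => ->; rewrite gal_id subrr mul0r.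
exact/(Sigma_gen _ Gt t1 Gs s1)/(Sigma_intro vg).
Qed.

Lemma ideal_of_Sigma_div x y : x / y \in O -> y != 0 ->
  ideal_of v (Sigma v s) y -> ideal_of v (Sigma v s) x.
Proof.
move=> Oxy y0 [y00|[g [vg Sg]]]; first by rewrite y00 eqxx in y0.
have [->|x0] := eqVneq x 0; first by left.
have [h vh] := val_some valv x0; right; exists h; split=> //.
by apply: (Sigma_up Sg (val_valgroupK vh)); rewrite -(valO_div ogle valv vh vg).
Qed.

Lemma is_ideal_Sigma : is_ideal le v (ideal_of v (Sigma v s)).
Proof.
split=> [x|||r x Or Jx].
- case=> [->|[g [vg /(Sigma_gt0 Gs)[_ /andP[g0 _]]]]]; first by rewrite /vring (val_zero valv).
  by rewrite /vring vg.
- by left.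
- move=> x y; have [->|x0] := eqVneq x 0; first by rewrite add0r.
  have [->|y0] := eqVneq y 0; first by rewrite addr0.
  move=> Jx Jy; have /orP[Oxy|Oyx] := valring_div O x0 y0.
    apply: (ideal_of_Sigma_div _ y0 Jy).
    by rewrite mulrDl divff // rpredD ?rpred1.
  apply: (ideal_of_Sigma_div _ x0 Jx).
  by rewrite mulrDl divff // rpredD ?rpred1.
have [->|x0] := eqVneq x 0; first by rewrite mulr0; left.
by apply: (ideal_of_Sigma_div _ x0 Jx); rewrite mulfK.
Qed.

Lemma ideal_div (I : L -> Prop) x y :
  is_ideal le v I -> I y -> y != 0 -> x / y \in O -> I x.
Proof. by case=> _ _ _ Imul Iy y0 Oxy; rewrite -[x](divfK y0); apply: Imul. Qed.

Lemma ideal_of_Sigma_min (I : L -> Prop) x : is_ideal le v I ->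
  (forall f, f != 0 -> I ((s f - f) / f)) -> ideal_of v (Sigma v s) x -> I x.
Proof.
move=> idI If [->|[g [vx [f [f0 sf vf]]]]]; first by case: idI.
apply: (ideal_div idI (If f f0)); first exact: (val_neq0 valv vf).
by rewrite (valO_div ogle valv vx vf) og_refl.
Qed.

Lemma gal_moves t : t != 1%g -> exists f, t f != f.
Proof.
move=> t1; apply: NNPP => nof; case/negP: t1; apply/gal_eqP => f _.
by rewrite gal_id; apply/eqP/negPn/negP => tf; apply: nof; exists f.
Qed.

Lemma final_segment_Sigma : final_segment_vK_gt0 le v (Sigma v s).
Proof.
by split=> [g|g h Sg Kh _ gh]; [apply: Sigma_gt0 | apply: Sigma_up gh].
Qed.

Lemma final_segmentL_Sigma : final_segment_vL_ge0 le v (Sigma v s).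
Proof.
split=> [g /(Sigma_gt0 Gs)[Kg /andP[g0 _]]|g h Sg Lh gh].
  by split=> //; apply: valgroupK_L.
by apply: (Sigma_up Sg) gh; apply: valgroup_eq.
Qed.

Lemma Sigma_plusE g : Sigma v s g <-> Sigma_plus le v 1%G g.
Proof.
split=> [Sg|[S [[SL Sup] GS Sg]]].
  have [Kg /andP[g0 _]] := Sigma_gt0 Gs Sg.
  (* The closed segment above [g] has trivial ramification group, because [Sigma v t] has elements
     below [g] for each [t != 1]. *)
  exists (fun h => valgroupL v h /\ le g h); split.
  - split=> [h [Lh gh]|h h' [_ gh] Lh' hh'].
      by split=> //; apply: og_trans gh.
    by split=> //; apply: (og_trans ogle gh).
  - move=> t [Gt It]; apply/set1P/eqP/negPn/negP => t1.
    have [h [f [f0 tf vf]]] := Sigma_no_min ((Sigma_gen g Gs s1 Gt t1).1 Sg).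
    rewrite glt_nle // => /negP; apply.
    by case: (It f f0) => [e0|[h' []]]; [move: vf; rewrite e0 (val_zero valv) | rewrite vf => -[<-] []].
  by split; [apply: valgroupK_L | apply: og_refl].
(* Since [s] is not in the group of [S], some value [h] in [Sigma v s] escapes [S]; the final
   segment [S] then lies above [h]. *)
have [f f0 nI] : exists2 f : L, f != 0 & ~ ideal_of v S ((s f - f) / f).
  apply: NNPP => nof; case/negP: s1; apply/eqP/set1P/GS; split=> // f f0.
  by apply: NNPP => nI; apply: nof; exists f.
have e0 : (s f - f) / f != 0 by apply/eqP => e0; apply: nI; left.
have [h vh] := val_some valv e0; have Sh := Sigma_intro vh.
have nSh : ~ S h by move=> Sh'; apply: nI; right; exists h.
have [Lg _] := SL g Sg.
apply: (Sigma_up Sh (valgroup_eq Lg)).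
have /orP[//|gh] := og_total ogle h g; case: nSh; apply: Sup Sg _ gh.
exact/valgroupK_L/val_valgroupK/vh.
Qed.

Lemma Sigma_minusE g : Sigma v s g <-> Sigma_minus le v 'Gal({:L} / 1%VS)%G g.
Proof.
split=> [[f [f0 sf vf]] S _ GS|Sg].
  have [_ /(_ f f0)] := GS s Gs.
  by case=> [e0|[h []]]; [move: vf; rewrite e0 (val_zero valv) | rewrite vf => -[<-]].
apply: Sg final_segmentL_Sigma _ => t Gt; split=> // f f0; exact: ideal_of_Sigma.
Qed.

Lemma I_minusE x : I_minus le v 'Gal({:L} / 1%VS)%G x <-> ideal_of v (Sigma v s) x.
Proof.
split=> [|Jx I idI GI_I].
  by apply=> [|t Gt]; [exact: is_ideal_Sigma | split=> // f; apply: ideal_of_Sigma].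
by apply: ideal_of_Sigma_min Jx => //; have [_] := GI_I s Gs.
Qed.

Lemma ideal_genE x : ideal_gen le v (ramif_elems s) x <-> ideal_of v (Sigma v s) x.
Proof.
split=> [|Jx I idI sI].
  by apply=> [|y [f [f0 ->]]]; [exact: is_ideal_Sigma | apply: ideal_of_Sigma].
by apply: ideal_of_Sigma_min Jx => // f f0; apply: sI; exists f.
Qed.

Lemma I_plusE x : I_plus le v 1%G x <-> ideal_of v (Sigma v s) x.
Proof.
split=> [[I [idI GI1 Ix]]|].
  have [->|x0] := eqVneq x 0; first by left.
  have [f f0 nI] : exists2 f : L, f != 0 & ~ I ((s f - f) / f).
    apply: NNPP => nof; case/negP: s1; apply/eqP/set1P/GI1; split=> // f f0.
    by apply: NNPP => nI; apply: nof; exists f.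
  have e0 : (s f - f) / f != 0 by apply/eqP => e0; apply: nI; rewrite e0; case: idI.
  apply: (ideal_of_Sigma_div _ e0 (ideal_of_Sigma Gs f0)).
  have /orP[//|Oex] := valring_div O x0 e0.
  (* If [x] divided the escaping element, that element would lie in [I]. *)
  by case: nI; apply: ideal_div Ix x0 Oex.
have [->|x0] := eqVneq x 0.
  (* For [x = 0] the zero ideal serves: only the identity fixes all of [L]. *)
  move=> _; exists (fun y => y = 0); split=> //.
  - split=> [y ->||y z -> ->|r y _ ->] //; rewrite ?addr0 ?mulr0 //.
    by rewrite /vring (val_zero valv).
  move=> t [Gt It]; apply/set1P/eqP/negPn/negP => /gal_moves[f tf].
  have f0 : f != 0 by apply: contraNneq tf => ->; rewrite rmorph0.
  have /eqP := It f f0; rewrite mulf_eq0 invr_eq0 (negPf f0) orbF subr_eq0.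
  by rewrite (negPf tf).
case=> [/eqP|[g [vx Sg]]]; first by rewrite (negPf x0).
have [_ /andP[g0 _]] := Sigma_gt0 Gs Sg.
(* The principal ideal of [x]; its group is trivial because [Sigma v t] has no least element. *)
exists (fun y => y / x \in O); split; last by rewrite divff // rpred1.
  split=> [y Oyx||y z Oy Oz|r y Or Oy].
  - by apply: (_ : y \in O); rewrite -[y](divfK x0) rpredM // in_valO vx.
  - by rewrite mul0r rpred0.
  - by rewrite mulrDl rpredD.
  by rewrite -mulrA rpredM.
move=> t [Gt It]; apply/set1P/eqP/negPn/negP => t1.
have [h [f [f0 tf vf]]] := Sigma_no_min ((Sigma_gen g Gs s1 Gt t1).1 Sg).
by rewrite glt_nle // => /negP; apply; rewrite -(valO_div ogle valv vf vx) It.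
Qed.
End Segments.


(** * Generators of [L]: the Artin-Schreier and Kummer cases *)

Lemma generator_gal s : generator 'Gal({:L} / 1%VS) s -> s \in G /\ s != 1%g.
Proof.
rewrite /generator => /eqP GE; split; first by rewrite GE cycle_id.
apply: contraTneq (prime_gt1 p_pr) => s1.
by rewrite -card_gal GE s1 cycle1 cards1.
Qed.

Lemma val_root_of_unity x n : x ^+ n.+1 = 1 -> v x = Some 0.
Proof.
move=> xn; have x0 : x != 0.
  by apply: contra_eq_neq xn => ->; rewrite expr0n /= eq_sym oner_neq0.
have nM y : y ^+ n.+1 = 1 -> y \in O -> y \notin M.
  by move=> yn Oy; rewrite -(maxidX n Oy) yn maxid1.
have xVn : x^-1 ^+ n.+1 = 1 by rewrite exprVn xn invr1.
have Ox : x \in O.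
  apply/negPn/negP => /notin_valring Mx; have := nM _ xVn (maxidO Mx).
  by rewrite Mx.
by apply: (@val_unit _ _ _ _ ogle valv) => //; apply: nM.
Qed.

Section Generator.
Variables (s : gal_of {:L}) (a : L).
Hypotheses (Gs : s \in G) (s1 : s != 1%g) (genL : <<1%VS; a>>%VS = {:L}%VS).

Lemma gen_poly f : exists r, [/\ r \in polyOver 1%VS, (size r <= p)%N & f = r.[a]].
Proof.
exists (Fadjoin_poly 1 a f); split; first exact: Fadjoin_polyOver.
  rewrite (leq_trans (size_Fadjoin_poly _ _ _)) //.
  by have := dim_Fadjoin 1 a; rewrite genL dimL dimv1 muln1 => ->.
by rewrite Fadjoin_poly_eq // genL memvf.
Qed.

Lemma gen_moved : s a != a.
Proof.
apply: contraNneq s1 => sa; apply/gal_eqP => f _.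
have [r [Kr _ ->]] := gen_poly f.
by rewrite gal_id -horner_gal // sa.
Qed.

Lemma gen_notin1 : a \notin 1%VS.
Proof. by apply: contra gen_moved => /(gal_mem1 s) ->. Qed.

(** The elements [f = a - c] give one inclusion. For the other, a resolved [f = r(a)] yields
    [u - g <= v d <= v (a - c)], and [v (a - K)] contains all values of [K] below one of its
    members. *)
Lemma Sigma_generator u : v (s a - a) = Some u ->
  forall g, Sigma v s g <-> exists (c : K) (d : Γ), v (a - c%:A) = Some d /\ g = u - d.
Proof.
move=> vu g; split=> [[f [f0 sf vf]]|[c [d [vd ->]]]]; last first.
  apply: (@Sigma_intro s (a - c%:A)); rewrite -(val_div valv vu vd); congr (v (_ / _)).
  by rewrite rmorphB /= galA; ring.
have [r [Kr szr fE]] := gen_poly f.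
have [c [d [Kc Kd d0 Oacd [R OR rE]]]] := gal_approximation gen_notin1 Kr szr.
have [dd vd] := val_some valv d0.
have ac0 : a - c != 0 by rewrite subr_eq0; apply: contraNneq gen_notin1 => ->.
have [gc vc] := val_some valv ac0.
pose y := (a - c) / d.
have syE : s y - y = (s a - a) / d.
  rewrite /y fmorph_div rmorphB /= (gal_mem1 s Kc) (gal_mem1 s Kd); field.
  by rewrite d0.
have rc z : r.[d * z + c] = r.[a] * R.[z].
  by rewrite -hornerZ -rE horner_comp !hornerE.
(* Hence [R.[y] = 1], and [(s f - f) / f] is [R.[s y] - R.[y]], an [O]-multiple of [s y - y]. *)
have fR : f = f * R.[y].
  by rewrite {2}fE -rc /y mulrC divfK // subrK.
have sfR : s f = f * R.[s y].
  rewrite {1 2}fE -rc -horner_gal //; congr (r.[_]).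
  rewrite /y fmorph_div rmorphB /= (gal_mem1 s Kc) (gal_mem1 s Kd).
  by rewrite mulrC divfK // subrK.
have Osy : s y \in O by rewrite galO.
have [B [OB _ RB]] := polyOver_factor OR Oacd.
have fB : (s f - f) / f = B.[s y] * ((s a - a) / d).
  rewrite -syE sfR {2}fR -mulrBr mulrAC divff // mul1r.
  by rewrite [in R.[s y]]RB !hornerE -/y addrC addKr.
have ug : le (u - g) dd.
  have Oq : ((s f - f) / f) / ((s a - a) / d) \in O.
    rewrite fB mulfK ?rpred_horner // mulf_neq0 ?invr_neq0 //.
    exact: (val_neq0 valv vu).
  move: Oq; rewrite (valO_div ogle valv vf (val_div valv vu vd)).
  by rewrite -(og_addr ogle (dd - g) (u - dd)) addrA subrK addrCA subrr addr0.
have dc : le dd gc by rewrite -(valO_div ogle valv vc vd).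
(* Choose [b] in [K] of value [u - g]. If this is below [v (a - c)], then [a - (c - b)] has the
   value of [b]; in case of equality [c] itself serves. *)
have [b [Kb b0 vb]] := exists_mem1_val (val_div valv vu vf).
have [ugc|nugc] := eqVneq (u - g) gc.
  have /mem1P[c' cE] := Kc; exists c', gc; rewrite -cE vc -ugc; split=> //.
  by rewrite subKr.
have /mem1P[c' cE] : c - b \in 1%VS by rewrite rpredB.
exists c', (u - g); rewrite -cE subKr; split=> //.
have -> : a - (c - b) = b + (a - c) by ring.
apply: (@valD_lt _ _ _ _ ogle valv) => //.
by rewrite (valM_div ogle valv vc vb) /glt (og_trans ogle ug dc).
Qed.

Lemma val_artin_schreier : p \in [pchar K] -> a ^+ p - a \in 1%VS -> v (s a - a) = Some 0.
Proof.
move=> pK Ka; have pL : p \in [pchar L] by rewrite pchar_lalg.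
have da0 : s a - a != 0 by rewrite subr_eq0 gen_moved.
have dE : (s a - a) ^+ p = s a - a.
  have := gal_mem1 s Ka; rewrite rmorphB rmorphXn /= => E.
  rewrite -(pFrobenius_autE pL) pFrobenius_autB_comm; last exact: mulrC.
  rewrite !pFrobenius_autE.
  by rewrite -[s a ^+ p](subrK (s a)) E; ring.
(* The additivity of Frobenius gave [(s a - a) ^+ p = s a - a], so [s a - a] is a root of unity of
   order dividing [p - 1 = p.-2.+1]. *)
apply: (@val_root_of_unity _ p.-2); apply: (mulfI da0).
have p2 : p.-2.+2 = p by case: (p) (prime_gt1 p_pr) => [|[]].
by rewrite -exprS mulr1 p2.
Qed.

(** With [z = s a / a], the integer [p] is the product of the [1 - z ^+ i] for [0 < i < p], all of
    the same value. *)
Lemma val_kummer : a ^+ p \in 1%VS -> v a = Some 0 ->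
  exists2 g0, v (s a - a) = Some g0 & v (p%:R : L) = Some (g0 *+ p.-1).
Proof.
move=> Ka va; have a0 := val_neq0 valv va.
pose z := s a / a; have z1 : z != 1.
  by rewrite -subr_eq0 -[1](divff a0) -mulrBl mulf_neq0 ?invr_neq0 // subr_eq0 gen_moved.
have zp : z ^+ p = 1.
  by rewrite expr_div_n -rmorphXn /= (gal_mem1 s Ka) divff // expf_neq0.
have zprim : p.-primitive_root z.
  have [m zm mp] := prim_order_exists (prime_gt0 p_pr) zp.
  have [m1|m1] := eqVneq m 1%N.
    by move: zm; rewrite m1 => /prim_expr_order; rewrite expr1 => /eqP; rewrite (negPf z1).
  by have /(prime_nt_dvdP p_pr m1) <- := mp.
have Oz : z \in O.
  by rewrite in_valO; have := @val_root_of_unity z p.-1; rewrite prednK ?prime_gt0 // => -> //=; rewrite og_refl.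
have z10 : 1 - z != 0 by rewrite subr_eq0 eq_sym.
have [g0 vg0] := val_some valv z10.
have saE : s a - a = (1 - z) * - a by rewrite /z; field; rewrite a0.
have Odiv w i : w \in O -> (1 - w ^+ i) / (1 - w) \in O.
  have [->|w1] := eqVneq w 1; first by rewrite expr1n subrr mul0r rpred0.
  move=> Ow; rewrite -opprB subrX1 -mulNr opprB mulrC mulKf ?subr_eq0 1?eq_sym //.
  by rewrite rpred_sum // => j _; rewrite rpredX.
have vzi i : (0 < i < p)%N -> v (1 - z ^+ i) = Some g0.
  case/andP=> i0 ip; have [u _ /dvdnP[w uE]] := Bezoutl p i0.
  have cop : coprime i p by rewrite coprime_sym prime_coprime // gtnNdvd.
  (* [z] and [z ^+ i] are powers of each other, so [1 - z] and [1 - z ^+ i] divide each other in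
     [O]. *)
  have zw : z = (z ^+ i) ^+ w.
    by rewrite -exprM mulnC -uE (eqP cop) exprD expr1 mulnC exprM zp expr1n mulr1.
  have zi0 : 1 - z ^+ i != 0.
    by rewrite subr_eq0; apply: contraNneq z1 => zi; rewrite zw -zi expr1n.
  rewrite -vg0; apply: (@val_eq _ _ _ _ ogle valv) => //; first exact: Odiv.
  by rewrite {1}zw Odiv // rpredX.
(* Both sides are the value at 1 of [(X ^ p - 1) / (X - 1)]. *)
have pE : p%:R = \prod_(1 <= i < p) (1 - z ^+ i).
  have := factor_Xn_sub_1 zprim; rewrite big_ltn ?prime_gt0 // expr0 subrX1.
  have X1 : 'X - 1 != 0 :> {poly L} by rewrite -polyC1 polyXsubC_eq0.
  rewrite polyC1 => /(mulfI X1)/(congr1 (horner^~ 1)).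
  rewrite horner_prod horner_sum; under eq_bigr do rewrite hornerXsubC.
  by move=> ->; under eq_bigr do rewrite hornerXn expr1n; rewrite sumr_const card_ord.
exists g0.
  rewrite saE (val_mul valv) vg0 -mulN1r (val_mul valv) va.
  by rewrite (@val_root_of_unity (-1) 1) ?sqrrN ?expr1n //= !addr0.
have vprod n : (n < p)%N -> v (\prod_(1 <= i < n.+1) (1 - z ^+ i)) = Some (g0 *+ n).
  elim: n => [|n IHn] np; first by rewrite big_geq // (val_one valv).
  by rewrite big_nat_recr //= (val_mul valv) IHn 1?ltnW // vzi //= -mulrSr.
have p1 : p.-1.+1 = p by rewrite prednK ?prime_gt0.
by rewrite pE -[in X in v X]p1 vprod // p1.
Qed.

End Generator.

End GaloisDefect.

Theorem theorem3p5 (p : nat) (K : fieldType) (L : splittingFieldType K)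
    (Γ : zmodType) (le : rel Γ) (v : L -> option Γ) :
  ordered_abelian_group le ->
  is_valuation le v ->
  prime p ->
  \dim {:L} = p ->
  galois 1%VS {:L} ->
  unique_extension le v ->
  nontrivial_defect le v ->
  (forall s t : gal_of {:L},
     generator 'Gal({:L} / 1%VS) s -> generator 'Gal({:L} / 1%VS) t ->
     forall g, Sigma v s g <-> Sigma v t g) /\
  (forall s : gal_of {:L}, generator 'Gal({:L} / 1%VS) s ->
   final_segment_vK_gt0 le v (Sigma v s) /\
       (forall g, Sigma v s g <-> Sigma_plus le v 1%G g) /\
       (forall g, Sigma v s g <-> Sigma_minus le v 'Gal({:L} / 1%VS)%G g) /\
       (forall x, I_minus le v 'Gal({:L} / 1%VS)%G x <-> I_plus le v 1%G x) /\
       (forall x, I_minus le v 'Gal({:L} / 1%VS)%G x <-> ideal_gen le v (ramif_elems s) x) /\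
       (p \in [pchar K] -> forall a : L,
          <<1%VS; a>>%VS = {:L}%VS -> a ^+ p - a \in 1%VS ->
          forall g, Sigma v s g <->
            exists (c : K) (d : Γ), v (a - c%:A) = Some d /\ g = - d) /\
       ((exists z : K, p.-primitive_root z) -> forall a : L,
          <<1%VS; a>>%VS = {:L}%VS -> a ^+ p \in 1%VS -> opos le (v (a - 1)) ->
          exists g0 dp : Γ, [/\ v (p%:R : L) = Some dp, g0 *+ (p.-1) = dp &
            forall g, Sigma v s g <->
              exists (c : K) (d : Γ), v (a - c%:A) = Some d /\ g = g0 - d])).
Proof.
move=> ogle valv p_pr dimL galL uniqv defect.
have genG := generator_gal p_pr dimL galL.
split=> [s t /genG[Gs s1] /genG[Gt t1] g|s /genG[Gs s1]].
  exact: (@Sigma_gen p K L Γ le v).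
split; first exact: (@final_segment_Sigma p).
split; first exact: (@Sigma_plusE p).
split; first exact: (@Sigma_minusE p).
have Im := I_minusE ogle valv p_pr dimL galL uniqv defect Gs s1.
split=> [x|].
  by rewrite Im (I_plusE ogle valv p_pr dimL galL uniqv defect Gs s1).
split=> [x|].
  by rewrite Im (ideal_genE ogle valv p_pr dimL galL uniqv defect Gs s1).
have Sgen := Sigma_generator ogle valv p_pr dimL galL uniqv defect s1.
split=> [pK a genL Ka g|_ a genL Ka Ma].
  rewrite (Sgen _ genL _ (val_artin_schreier ogle valv p_pr dimL s1 genL pK Ka)).
  by split=> -[c [d [vd ->]]]; exists c, d; rewrite sub0r.
have va : v a = Some 0.
  have aE : a = 1 + (a - 1) by ring.
  rewrite aE; apply: (@valD_lt _ _ _ _ ogle valv); first exact: val_one valv.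
  by rewrite divr1 in_valM.
have [g0 vg0 vp] := val_kummer ogle valv p_pr dimL s1 genL Ka va.
(* [g0], the value of [s a - a], plays the part of [vp / (p - 1)]. *)
exists g0, (g0 *+ p.-1); split=> //; exact: Sgen vg0.
Qed.
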